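(* Let $R$ be a commutative ring with identity and let $S$ be a multiplicative set of $R$. Let $I$ be an ideal of $R$ which admits an $S$-primary decomposition, and let $I=\bigcap_{i=1}^{n}Q_i$ be a minimal $S$-primary decomposition, where $Q_i$ is $P_i$-$S$-primary for each $i\in\{1,2,\ldots,n\}$. Then the ideals $S(P_i)$ $(1\le i\le n)$ are precisely the prime ideals which occur in the set of ideals $\{S(\mathrm{rad}(I:x))\mid x\in R\}$; hence the set $\{S(P_1),\ldots,S(P_n)\}$ is independent of the particular minimal $S$-primary decomposition of $I$.
   Context: A multiplicative set $S\subseteq R$ contains $1$ and is closed under multiplication. $\mathrm{rad}(I)=\{x\in R\mid x^n\in I\text{ for some }n>0\}$ and $(I:x)=\{r\in R\mid rx\in I\}$. For an ideal $I$ of $R$, $S(I)=\{a\in R\mid \frac{a}{1}\in S^{-1}I\}$ denotes the contraction of $S^{-1}I$ along $R\to S^{-1}R$. An ideal $Q$ of $R$ with $Q\cap S=\emptyset$ is $S$-primary if there exists $s\in S$ such that for all $a,b\in R$ with $ab\in Q$, we have $sa\in Q$ or $sb\in\mathrm{rad}(Q)$; it is called $P$-$S$-primary if moreover $P=\mathrm{rad}(Q)$. An ideal $I$ of $R$ with $I\cap S=\emptyset$ admits an $S$-primary decomposition if it is a finite intersection of $S$-primary ideals of $R$. An $S$-primary decomposition $I=\bigcap_{i=1}^n Q_i$ with $\mathrm{rad}(Q_i)=P_i$ is minimal if (1) $S(P_i)\ne S(P_j)$ for all distinct $i,j\in\{1,\ldots,n\}$, and (2) $S(Q_i)\nsupseteq\bigcap_{j\in\{1,\ldots,n\}\setminus\{i\}}S(Q_j)$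 for each $i\in\{1,\ldots,n\}$. *)

(* Defs.v *)
From HB Require Import structures.
From mathcomp Require Import all_boot all_order all_algebra generic_quotient.
From mathcomp Require Import boolp classical_sets.
From mathcomp Require Import ring.

Set Implicit Arguments.
Unset Strict Implicit.
Unset Printing Implicit Defensive.

Import GRing.Theory.

Local Open Scope ring_scope.
Local Open Scope quotient_scope.
Local Open Scope classical_set_scope.

(* A multiplicative set is an [S : mulrClosed R], that is, a predicate on [R]
   that contains 1 and is closed under multiplication.  It is boolean-valued,
   which is no restriction here: every subset is decidable by [boolp]. *)

(* The library only has the localization of a domain at its nonzero elements
   ([fraction]), so S^-1 R is constructed here for an arbitrary commutative
   ring, possibly trivial, and an arbitrary multiplicative set, possibly
   containing zero divisors or 0. *)
Section Localization.
Variables (R : comPzRingType) (S : mulrClosed R).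

Local Notation lpair := (R * {s : R | s \in S})%type.

Definition LPair (a s : R) (sS : s \in S) : lpair := (a, exist _ s sS).
Arguments LPair a [s] sS.

Definition num (x : lpair) : R := x.1.
Definition den (x : lpair) : R := sval x.2.

Lemma denP x : den x \in S. Proof. by case: x => a [s sS]. Qed.

Definition eqloc (x y : lpair) : bool :=
  `[< exists2 u, u \in S & u * (num x * den y - num y * den x) = 0 >].

Lemma eqlocP x y :
  reflect (exists2 u, u \in S & u * (num x * den y - num y * den x) = 0)
          (eqloc x y).
Proof. exact: asboolP. Qed.

Lemma eqloc_refl : reflexive eqloc.
Proof. by move=> x; apply/eqlocP; exists 1; rewrite ?rpred1 // subrr mulr0. Qed.

Lemma eqloc_sym : symmetric eqloc.
Proof.
have sub x y : eqloc x y -> eqloc y x.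
  case/eqlocP=> u uS e; apply/eqlocP; exists u => //.
  by rewrite -opprB mulrN e oppr0.
by move=> x y; apply/idP/idP; apply: sub.
Qed.

Lemma eqloc_trans : transitive eqloc.
Proof.
move=> y x z /eqlocP[u uS eu] /eqlocP[v vS ev]; apply/eqlocP.
exists (u * v * den y); first by rewrite !rpredM ?denP.
have -> : u * v * den y * (num x * den z - num z * den x) =
  v * den z * (u * (num x * den y - num y * den x)) +
  u * den x * (v * (num y * den z - num z * den y)) by ring.
by rewrite eu ev !mulr0 addr0.
Qed.

Canonical eqloc_equiv := EquivRel eqloc eqloc_refl eqloc_sym eqloc_trans.

Definition localization : Type := {eq_quot eqloc}.
HB.instance Definition _ : EqQuotient _ eqloc localization :=
  EqQuotient.on localization.
HB.instance Definition _ := Choice.on localization.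

Definition lfrac (a s : R) (sS : s \in S) : localization :=
  \pi_localization (LPair a sS).

Lemma lfracP a s (sS : s \in S) b t (tS : t \in S) :
  lfrac a sS = lfrac b tS <-> exists2 u, u \in S & u * (a * t - b * s) = 0.
Proof.
split=> [/eqquotP /eqlocP //|e].
by apply/eqquotP; apply/eqlocP.
Qed.

Lemma lfrac_surj (z : localization) :
  exists a s (sS : s \in S), z = lfrac a sS.
Proof.
elim/quotW: z => -[a [s sS]].
by exists a, s, sS.
Qed.

Definition addl (x y : lpair) : lpair :=
  LPair (num x * den y + num y * den x) (rpredM (denP x) (denP y)).
Definition oppl (x : lpair) : lpair := LPair (- num x) (denP x).
Definition mull (x y : lpair) : lpair :=
  LPair (num x * num y) (rpredM (denP x) (denP y)).

Definition ladd := lift_op2 localization addl.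
Definition lopp := lift_op1 localization oppl.
Definition lmul := lift_op2 localization mull.
Definition lzero : localization := lfrac 0 (rpred1 S).
Definition lone : localization := lfrac 1 (rpred1 S).

Lemma pi_ladd : {morph \pi_localization : x y / addl x y >-> ladd x y}.
Proof.
move=> x y; unlock ladd; apply/eqquotP.
have /eqquotP/eqlocP[u uS eu] := esym (reprK (\pi_localization x)).
have /eqquotP/eqlocP[v vS ev] := esym (reprK (\pi_localization y)).
move: (repr (\pi_localization x)) (repr (\pi_localization y)) eu ev.
move=> x' y' eu ev.
apply/eqlocP; exists (u * v); first exact: rpredM.
transitivity (
  v * den y * den y' * (u * (num x * den x' - num x' * den x)) +
  u * den x * den x' * (v * (num y * den y' - num y' * den y))); last first.
  by rewrite eu ev !mulr0 addr0.
by rewrite /num /den /= /num /den; ring.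
Qed.
Canonical pi_ladd_morph := PiMorph2 pi_ladd.

Lemma pi_lopp : {morph \pi_localization : x / oppl x >-> lopp x}.
Proof.
move=> x; unlock lopp; apply/eqquotP.
have /eqquotP/eqlocP[u uS eu] := esym (reprK (\pi_localization x)).
move: (repr _) eu => x' eu; apply/eqlocP; exists u => //.
transitivity (- (u * (num x * den x' - num x' * den x))); last first.
  by rewrite eu oppr0.
by rewrite /num /den /= /num /den; ring.
Qed.
Canonical pi_lopp_morph := PiMorph1 pi_lopp.

Lemma pi_lmul : {morph \pi_localization : x y / mull x y >-> lmul x y}.
Proof.
move=> x y; unlock lmul; apply/eqquotP.
have /eqquotP/eqlocP[u uS eu] := esym (reprK (\pi_localization x)).
have /eqquotP/eqlocP[v vS ev] := esym (reprK (\pi_localization y)).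
move: (repr (\pi_localization x)) (repr (\pi_localization y)) eu ev.
move=> x' y' eu ev.
apply/eqlocP; exists (u * v); first exact: rpredM.
transitivity (
  v * num y * den y' * (u * (num x * den x' - num x' * den x)) +
  u * num x' * den x * (v * (num y * den y' - num y' * den y))); last first.
  by rewrite eu ev !mulr0 addr0.
by rewrite /num /den /= /num /den; ring.
Qed.
Canonical pi_lmul_morph := PiMorph2 pi_lmul.

Lemma lfracD a s (sS : s \in S) b t (tS : t \in S) :
  ladd (lfrac a sS) (lfrac b tS) = lfrac (a * t + b * s) (rpredM sS tS).
Proof.
rewrite /lfrac -pi_ladd; apply/lfracP; exists 1; first exact: rpred1.
by rewrite subrr mulr0.
Qed.

Lemma lfracN a s (sS : s \in S) : lopp (lfrac a sS) = lfrac (- a) sS.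
Proof.
rewrite /lfrac -pi_lopp; apply/lfracP; exists 1; first exact: rpred1.
by rewrite subrr mulr0.
Qed.

Lemma lfracM a s (sS : s \in S) b t (tS : t \in S) :
  lmul (lfrac a sS) (lfrac b tS) = lfrac (a * b) (rpredM sS tS).
Proof.
rewrite /lfrac -pi_lmul; apply/lfracP; exists 1; first exact: rpred1.
by rewrite subrr mulr0.
Qed.

Let lfracE a s (sS : s \in S) b t (tS : t \in S) :
  a * t = b * s -> lfrac a sS = lfrac b tS.
Proof. by move=> e; apply/lfracP; exists 1; rewrite ?rpred1 // e subrr mulr0. Qed.

Lemma laddA : associative ladd.
Proof.
move=> x y z; have [a [s [sS ->]]] := lfrac_surj x.
have [b [t [tS ->]]] := lfrac_surj y; have [c [r [rS ->]]] := lfrac_surj z.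
by rewrite !lfracD; apply: lfracE; ring.
Qed.

Lemma laddC : commutative ladd.
Proof.
move=> x y; have [a [s [sS ->]]] := lfrac_surj x.
have [b [t [tS ->]]] := lfrac_surj y.
by rewrite !lfracD; apply: lfracE; ring.
Qed.

Lemma ladd0 : left_id lzero ladd.
Proof.
move=> x; have [a [s [sS ->]]] := lfrac_surj x.
by rewrite lfracD; apply: lfracE; ring.
Qed.

Lemma laddN : left_inverse lzero lopp ladd.
Proof.
move=> x; have [a [s [sS ->]]] := lfrac_surj x.
by rewrite lfracN lfracD; apply: lfracE; ring.
Qed.

HB.instance Definition _ :=
  GRing.isZmodule.Build localization laddA laddC ladd0 laddN.

Lemma lmulA : associative lmul.
Proof.
move=> x y z; have [a [s [sS ->]]] := lfrac_surj x.
have [b [t [tS ->]]] := lfrac_surj y; have [c [r [rS ->]]] := lfrac_surj z.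
by rewrite !lfracM; apply: lfracE; ring.
Qed.

Lemma lmulC : commutative lmul.
Proof.
move=> x y; have [a [s [sS ->]]] := lfrac_surj x.
have [b [t [tS ->]]] := lfrac_surj y.
by rewrite !lfracM; apply: lfracE; ring.
Qed.

Lemma lmul1 : left_id lone lmul.
Proof.
move=> x; have [a [s [sS ->]]] := lfrac_surj x.
by rewrite lfracM; apply: lfracE; ring.
Qed.

Lemma lmulDl : left_distributive lmul ladd.
Proof.
move=> x y z; have [a [s [sS ->]]] := lfrac_surj x.
have [b [t [tS ->]]] := lfrac_surj y; have [c [r [rS ->]]] := lfrac_surj z.
by rewrite lfracD !lfracM lfracD; apply: lfracE; ring.
Qed.

HB.instance Definition _ :=
  GRing.Zmodule_isComPzRing.Build localization lmulA lmulC lmul1 lmulDl.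

Definition toloc (a : R) : localization := lfrac a (rpred1 S).

Lemma toloc_is_zmod_morphism : zmod_morphism toloc.
Proof.
move=> a b; rewrite /toloc -[RHS]/(ladd _ (lopp _)) lfracN lfracD.
by apply: lfracE; ring.
Qed.

Lemma toloc_is_monoid_morphism : monoid_morphism toloc.
Proof.
split=> // a b; rewrite /toloc -[RHS]/(lmul _ _) lfracM.
by apply: lfracE; ring.
Qed.

HB.instance Definition _ :=
  GRing.isZmodMorphism.Build R localization toloc toloc_is_zmod_morphism.
HB.instance Definition _ :=
  GRing.isMonoidMorphism.Build R localization toloc toloc_is_monoid_morphism.

Definition locideal (I : set R) : set localization :=
  [set z | exists a s (sS : s \in S), I a /\ z = lfrac a sS].

(* S(I): the contraction of S^-1 I along R -> S^-1 R. *)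
Definition contraction (I : set R) : set R := toloc @^-1` locideal I.

End Localization.

Section Ideals.
Variable R : comPzRingType.
Implicit Types (I P Q : set R) (x : R).

(* The library's [idealr_closed] and [prime_idealr_closed] are not used: they
   require a nontrivial ring, and the former makes every ideal proper, whereas
   (I : x) may be the unit ideal. *)
Definition is_ideal I : Prop :=
  [/\ I 0, forall a b, I a -> I b -> I (a + b) & forall r a, I a -> I (r * a)].

Definition is_prime_ideal P : Prop :=
  [/\ is_ideal P, ~ P 1 & forall a b, P (a * b) -> P a \/ P b].

Definition radical I : set R := [set x | exists2 n, (0 < n)%N & I (x ^+ n)].

Definition colon I x : set R := [set r | I (r * x)].

Variable S : mulrClosed R.

Definition S_primary Q : Prop :=
  [/\ is_ideal Q, [set` S] `&` Q = set0 &
    exists2 s, s \in S &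
      forall a b, Q (a * b) -> Q (s * a) \/ radical Q (s * b)].

Definition P_S_primary P Q : Prop := S_primary Q /\ P = radical Q.

Definition S_primary_decomposition I n (Q : 'I_n -> set R) : Prop :=
  [/\ is_ideal I, [set` S] `&` I = set0, forall i, S_primary (Q i) &
    I = \bigcap_(i in [set: 'I_n]) Q i].

Definition admits_S_primary_decomposition I : Prop :=
  exists n (Q : 'I_n -> set R), S_primary_decomposition I Q.

Definition minimal_S_primary_decomposition I n (P Q : 'I_n -> set R) : Prop :=
  [/\ S_primary_decomposition I Q,
      forall i, P_S_primary (P i) (Q i),
      forall i j, i <> j -> contraction S (P i) <> contraction S (P j) &
      forall i, ~ (\bigcap_(j in [set j | j <> i]) contraction S (Q j)
                     `<=` contraction S (Q i))].

End Ideals.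

(* Main.v *)
(* For an ideal I, the contraction S(I) is {a | u a in I for some u in S}.  It
   commutes with finite intersections, as do radicals and colons by x, so
   S(rad(I : x)) is the intersection of the S(rad(Q_i : x)).  If Q is S-primary,
   then S(rad(Q : x)) is the whole ring when x is in S(Q) and the prime ideal
   S(rad Q) otherwise.  Hence S(rad(I : x)) is the intersection of the primes
   S(P_i) with x not in S(Q_i).  If it is prime, it is one of them; and by
   minimality every i is isolated by some x. *)
Require Import Defs.
From mathcomp Require Import all_boot all_order all_algebra.
From mathcomp Require Import boolp classical_sets.
From mathcomp Require Import ring.

Set Implicit Arguments.
Unset Strict Implicit.
Unset Printing Implicit Defensive.

Import GRing.Theory.

Local Open Scope ring_scope.
Local Open Scope classical_set_scope.

Section Ideals.
Variable R : comPzRingType.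
Implicit Types (A p : set R) (x y : R).

Lemma ideal_expr_leq A y m n : is_ideal A -> (m <= n)%N ->
  A (y ^+ m) -> A (y ^+ n).
Proof. by move=> [_ _ AM] mn Am; rewrite -(subnK mn) exprD; apply: AM. Qed.

Lemma is_ideal_colon A x : is_ideal A -> is_ideal (colon A x).
Proof.
move=> [A0 AD AM]; split=> [|a b|r a]; rewrite /colon /=.
- by rewrite mul0r.
- by rewrite mulrDl; apply: AD.
- by rewrite -mulrA; apply: AM.
Qed.

Lemma is_ideal_radical A : is_ideal A -> is_ideal (radical A).
Proof.
move=> idA; have [A0 AD AM] := idA; split.
- by exists 1%N.
- move=> a b [m m0 Am] [k k0 Ak]; exists (m + k)%N.
    by rewrite addn_gt0 m0.
  rewrite exprDn; apply: big_ind => // -[i /= _] _.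
  rewrite -mulr_natl; apply: (AM).
  (* The [i]-th binomial term is a multiple of [a ^+ (m + k - i) * b ^+ i]: either [k <= i], or
     [i < k] and the exponent of [a] is at least [m]. *)
  case: (leqP k i) => ki; last first.
    by rewrite mulrC; apply: AM; apply: ideal_expr_leq Am;
      rewrite // -addnBA ?leq_addr // ltnW.
  by apply: AM; apply: ideal_expr_leq Ak.
- by move=> r a [m m0 Am]; exists m => //; rewrite exprMn; apply: AM.
Qed.

Lemma prime_ideal_expr p y n : is_prime_ideal p -> p (y ^+ n) -> p y.
Proof.
move=> [_ p1 pM]; elim: n => [|n IH]; first by rewrite expr0.
by rewrite exprS => /pM[].
Qed.

Lemma radical_bigcap n (A : 'I_n -> set R) : (forall i, is_ideal (A i)) ->
  radical (\bigcap_(i in [set: 'I_n]) A i) =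
  \bigcap_(i in [set: 'I_n]) radical (A i).
Proof.
move=> idA; apply/seteqP; split=> [y [k k0 Ak] i _|y Ay].
  by exists k => //; apply: Ak.
have /choice[k kP] i : exists k, A i (y ^+ k) by have [k _] := Ay i I; exists k.
(* The successor keeps the common exponent positive, even for an empty family. *)
exists (\max_i k i).+1 => // i _; apply: ideal_expr_leq (kP i) => //.
exact/leqW/leq_bigmax.
Qed.

(** If every [A i] with [T i] had an element outside [p], the product of these elements would lie in
    the intersection but, [p] being prime, not in [p]. *)
Lemma prime_ideal_bigcap n (T : set 'I_n) (A : 'I_n -> set R) p :
  (forall i, is_ideal (A i)) -> is_prime_ideal p ->
  \bigcap_(i in T) A i `<=` p -> exists2 i, T i & A i `<=` p.
Proof.
move=> idA [_ p1 pM] Ap; apply: contrapT => noi.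
have /choice[y yP] i : exists y, (T i -> A i y) /\ ~ p y.
  (* Indices outside [T] get the neutral factor 1, which is not in [p], so the product can run over
     all of ['I_n]. *)
  have [Ti|nTi] := pselect (T i); last by exists 1.
  have /existsNP[y /not_implyP[Ay py]] : ~ (A i `<=` p).
    by move=> Aip; apply: noi; exists i.
  by exists y.
have : ~ p (\prod_i y i).
  apply: (big_ind (fun x => ~ p x)) => // [a b pa pb /pM[]|i _] //.
  by have [] := yP i.
apply; apply: Ap => i Ti; rewrite (bigD1 i) //= mulrC.
by have [_ _ AM] := idA i; apply: AM; apply: (yP i).1.
Qed.

End Ideals.

Section Contraction.
Variables (R : comPzRingType) (S : mulrClosed R).
Implicit Types (A Q : set R) (x y : R).

Lemma contractionP A x : is_ideal A ->
  contraction S A x <-> exists2 u, u \in S & A (u * x).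
Proof.
move=> [A0 AD AM]; split.
  move=> [b [s [sS [Ab /lfracP[u uS]]]]].
  rewrite mulr1 mulrBr => /eqP; rewrite subr_eq0 => /eqP e.
  (* From [x / 1 = b / s] comes [u * s * x = u * b], which lies in [A]. *)
  exists (u * s); first exact: rpredM.
  by rewrite -mulrA [s * x]mulrC e; apply: AM.
move=> [u uS Aux]; exists (u * x), u, uS; split=> //.
by apply/lfracP; exists 1; [exact: rpred1|ring].
Qed.

Lemma sub_contraction A : is_ideal A -> A `<=` contraction S A.
Proof.
by move=> idA a Aa; apply/contractionP => //; exists 1; rewrite ?rpred1 ?mul1r.
Qed.

Lemma is_ideal_contraction A : is_ideal A -> is_ideal (contraction S A).
Proof.
move=> idA; have [A0 AD AM] := idA; split.
- exact: sub_contraction.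
- move=> a b /(contractionP _ idA)[u uS ua] /(contractionP _ idA)[v vS vb].
  apply/contractionP => //; exists (u * v); first exact: rpredM.
  have -> : u * v * (a + b) = v * (u * a) + u * (v * b) by ring.
  by apply: AD; apply: AM.
- move=> r a /(contractionP _ idA)[u uS ua].
  by apply/contractionP => //; exists u => //; rewrite mulrCA; apply: AM.
Qed.

Lemma contraction_bigcap n (A : 'I_n -> set R) : (forall i, is_ideal (A i)) ->
  contraction S (\bigcap_(i in [set: 'I_n]) A i) =
  \bigcap_(i in [set: 'I_n]) contraction S (A i).
Proof.
move=> idA; have idI : is_ideal (\bigcap_(i in [set: 'I_n]) A i).
  split=> [i _|a b Aa Ab i _|r a Aa i _]; have [A0 AD AM] := idA i => //.
  - by apply: AD; [apply: Aa|apply: Ab].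
  - by apply: AM; apply: Aa.
apply/seteqP; split=> [y /(contractionP _ idI)[u uS Au] i _|y Ay].
  by apply/contractionP => //; exists u => //; apply: Au.
have /choice[u uP] i : exists u, u \in S /\ A i (u * y).
  by have /(contractionP _ (idA i))[u] := Ay i I; exists u.
(* Since there are finitely many indices, the product of the multipliers is one element of [S] that
   serves every [A i]. *)
apply/contractionP => //; exists (\prod_i u i).
  by apply: rpred_prod => i _; have [] := uP i.
move=> i _; rewrite (bigD1 i) //= mulrAC mulrC.
by have [_ _ AM] := idA i; apply: AM; apply: (uP i).2.
Qed.

(** Contraction commutes with radicals: a multiplier [u] for [x] gives [u ^+ n] for [x ^+ n], and
    conversely [(u * x) ^+ n] is a multiple of [u * x ^+ n] when [n > 0]. *)
Lemma contraction_radicalP A x : is_ideal A ->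
  contraction S (radical A) x <->
  exists2 n, (0 < n)%N & contraction S A (x ^+ n).
Proof.
move=> idA; have idr := is_ideal_radical idA; have [_ _ AM] := idA; split.
  move=> /(contractionP _ idr)[u uS [n n0]]; rewrite exprMn => Aux.
  exists n => //; apply/contractionP => //.
  by exists (u ^+ n) => //; apply: rpredX.
move=> [[//|n] _ /(contractionP _ idA)[u uS Aux]].
apply/contractionP => //; exists u => //; exists n.+1 => //.
by rewrite exprMn (exprSr u) -mulrA; apply: AM.
Qed.

Lemma contraction_colon A x y : is_ideal A ->
  contraction S (colon A x) y <-> contraction S A (y * x).
Proof.
move=> idA; have idc := is_ideal_colon x idA.
split=> [/(contractionP _ idc)|/(contractionP _ idA)] [u uS Au];
  by apply/contractionP => //; exists u; rewrite // /colon /= ?mulrA // -mulrA.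
Qed.

(** Contraction absorbs the factor [s] of the [S]-primary condition, leaving the ordinary primary
    condition for [contraction S Q]. *)
Lemma S_primary_contraction Q x y : S_primary S Q ->
  contraction S Q (x * y) -> contraction S Q x \/ contraction S (radical Q) y.
Proof.
move=> [idQ _ [s sS Qs]] /(contractionP _ idQ)[u uS].
rewrite mulrA => /Qs[Qx|Qy].
  left; apply/contractionP => //; exists (s * u); first exact: rpredM.
  by rewrite -mulrA.
by right; apply/contractionP; [exact: is_ideal_radical|exists s].
Qed.

Lemma S_primary_prime Q : S_primary S Q ->
  is_prime_ideal (contraction S (radical Q)).
Proof.
move=> prQ; have [idQ SQ0 _] := prQ; have idr := is_ideal_radical idQ.
split; first exact: is_ideal_contraction.
  (* If 1 were in the contraction, some element of [S] would lie in [Q]. *)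
  move=> /(contraction_radicalP _ idQ)[n _]; rewrite expr1n.
  move=> /(contractionP _ idQ)[u uS]; rewrite mulr1 => Qu.
  by suff : set0 u by []; rewrite -SQ0.
move=> a b /(contraction_radicalP _ idQ)[n n0]; rewrite exprMn.
case/(S_primary_contraction prQ) => [an|/(contraction_radicalP _ idQ)[k k0 bnk]].
  by left; apply/contraction_radicalP => //; exists n.
right; apply/contraction_radicalP => //; exists (n * k)%N.
  by rewrite muln_gt0 n0.
by rewrite exprM.
Qed.

(** If [x * y ^+ n] is in [contraction S Q] and [x] is not, the primary condition puts [y ^+ n],
    hence [y], in the prime [contraction S (radical Q)]. *)
Lemma contraction_radical_colon Q x : S_primary S Q -> ~ contraction S Q x ->
  contraction S (radical (colon Q x)) = contraction S (radical Q).
Proof.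
move=> prQ nQx; have [idQ _ _] := prQ; have idc := is_ideal_colon x idQ.
apply/seteqP; split=> y.
  move=> /(contraction_radicalP _ idc)[n _ /(contraction_colon _ _ idQ)].
  rewrite mulrC => /(S_primary_contraction prQ)[//|].
  by move=> yn; apply: prime_ideal_expr (S_primary_prime prQ) yn.
move=> /(contraction_radicalP _ idQ)[n n0 Qy].
apply/contraction_radicalP => //; exists n => //; apply/contraction_colon => //.
by rewrite mulrC; have [_ _] := is_ideal_contraction idQ; apply.
Qed.

Lemma contraction_radical_colonT Q x : is_ideal Q -> contraction S Q x ->
  contraction S (radical (colon Q x)) = [set: R].
Proof.
move=> idQ Qx; have idc := is_ideal_colon x idQ.
apply/seteqP; split=> // y _.
apply/contraction_radicalP => //; exists 1%N => //.
apply/contraction_colon => //.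
by have [_ _ QM] := is_ideal_contraction idQ; apply: QM.
Qed.

Lemma contraction_radical_colon_bigcap n (Q : 'I_n -> set R) x :
  (forall i, S_primary S (Q i)) ->
  contraction S (radical (colon (\bigcap_(i in [set: 'I_n]) Q i) x)) =
  \bigcap_(i in [set i | ~ contraction S (Q i) x]) contraction S (radical (Q i)).
Proof.
move=> prQ; have idQ i : is_ideal (Q i) by have [] := prQ i.
have -> : colon (\bigcap_(i in [set: 'I_n]) Q i) x =
          \bigcap_(i in [set: 'I_n]) colon (Q i) x by [].
have idc i := is_ideal_colon x (idQ i).
rewrite radical_bigcap // contraction_bigcap; last first.
  by move=> i; apply: is_ideal_radical.
apply/seteqP; split=> y Ay i => [nQx|_].
  by rewrite -(contraction_radical_colon (prQ i) nQx); apply: Ay.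
have [Qx|nQx] := pselect (contraction S (Q i) x).
  by rewrite contraction_radical_colonT.
by rewrite contraction_radical_colon //; apply: Ay.
Qed.

Lemma minimal_S_primary_decomposition_primes A n (P Q : 'I_n -> set R) :
  minimal_S_primary_decomposition S A P Q ->
  [set contraction S (P i) | i in [set: 'I_n]] =
    [set p | is_prime_ideal p] `&`
      [set contraction S (radical (colon A x)) | x in [set: R]].
Proof.
move=> [[_ _ prQ ->] PQ _ irr].
have idQ i : is_ideal (Q i) by have [] := prQ i.
have PE i : P i = radical (Q i) by have [] := PQ i.
apply/seteqP; split=> [_ [i _ <-]|p [prp [x _ pE]]].
  rewrite PE; split; first exact: S_primary_prime.
  (* Irredundancy gives an [x] in every [contraction S (Q j)] with [j <> i] but not in
     [contraction S (Q i)], so only the index [i] survives in the intersection. *)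
  have /existsNP[x /not_implyP[Qjx nQix]] := irr i.
  exists x => //; rewrite contraction_radical_colon_bigcap //.
  apply/seteqP; split=> y => [|Qy j nQjx]; first by apply.
  have [->//|ji] := pselect (j = i).
  by case: nQjx; apply: Qjx.
move: pE; rewrite contraction_radical_colon_bigcap // => pE.
have idP i : is_ideal (contraction S (radical (Q i))).
  exact/is_ideal_contraction/is_ideal_radical/idQ.
(* Rewriting the left-hand [p] as the intersection makes one component lie inside [p]; the other
   inclusion holds because [p] is that intersection. *)
have := @subset_refl _ p; rewrite -{1}pE.
move=> /(prime_ideal_bigcap idP prp)[i nQx ip].
exists i => //; rewrite PE; apply/seteqP; split=> // y.
by rewrite -pE; apply.
Qed.

End Contraction.

Theorem theorem16 (R : comPzRingType) (S : mulrClosed R) (I : set R)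
    (hI : is_ideal I) (hdec : admits_S_primary_decomposition S I)
    (n : nat) (P Q : 'I_n -> set R)
    (hmin : minimal_S_primary_decomposition S I P Q) :
  [set contraction S (P i) | i in [set: 'I_n]] =
    [set p | is_prime_ideal p] `&`
      [set contraction S (radical (colon I x)) | x in [set: R]]
  /\
  forall (m : nat) (P' Q' : 'I_m -> set R),
    minimal_S_primary_decomposition S I P' Q' ->
    [set contraction S (P' i) | i in [set: 'I_m]] =
      [set contraction S (P i) | i in [set: 'I_n]].
Proof.
split=> [|m P' Q' hmin'].
  exact: minimal_S_primary_decomposition_primes hmin.
(* Both sets equal one that is defined from [I] and [S] alone. *)
by rewrite (minimal_S_primary_decomposition_primes hmin)
  (minimal_S_primary_decomposition_primes hmin').
Qed.
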